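(* Let $t:[0,1]\to[0,\infty]$ be a left continuous non-decreasing function and $F\in\varGamma$. Let $T:[0,1]^2\to[0,1]$ be given by $T(x,y)=t^{[-1]}(F(t(x),t(y)))$. Then $T$ is idempotent (that is, $T(x,x)=x$ for all $x\in[0,1]$) if and only if $t$ is strictly increasing on $[0,1]$ and $F(t(x),t(x))\le t(x^+)$ for all $x\in[0,1)$.
   Context: $\varGamma$ is the set of all functions $F:[0,\infty]^2\to[0,\infty]$ such that $([0,\infty],F,\le)$ is a fully ordered Abelian semigroup (i.e. $F$ is associative, commutative and non-decreasing in each argument) and $F(x,0)\ge x$ for all $x\in[0,\infty]$. For non-decreasing $t:[0,1]\to[0,\infty]$, the weak pseudo-inverse $t^{[-1]}:[0,\infty]\to[0,1]$ is $t^{[-1]}(y)=\sup\{x\in[0,1]\mid t(x)\le y\}$ (with $\sup\emptyset=0$) if $t$ is non-constant, and $t^{[-1]}(y)=1$ for all $y$ if $t$ is constant. $t(x^+)=\lim_{s\to x^+}t(s)$ for $x\in[0,1)$. *)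

(* Defs.v *)
From HB Require Import structures.
From mathcomp Require Import all_boot all_order all_algebra.
From mathcomp Require Import all_classical all_reals all_analysis.
Import Order.TTheory GRing.Theory Num.Theory.
Import numFieldNormedType.Exports.

Set Implicit Arguments.
Unset Strict Implicit.
Unset Printing Implicit Defensive.

Local Open Scope classical_set_scope.
Local Open Scope ring_scope.

(* Maps on [0,1], resp. [0,+oo], are represented by total maps on R, resp.
   \bar R; every condition below only involves their values on [0,1], resp.
   on the nonnegative extended reals. *)

Record in_Gamma (R : realType) (F : \bar R -> \bar R -> \bar R) : Prop := {
  Gamma_ge0 : forall x y, (0 <= x -> 0 <= y -> 0 <= F x y)%E;
  Gamma_assoc : forall x y z, (0 <= x -> 0 <= y -> 0 <= z ->
    F x (F y z) = F (F x y) z)%E;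
  Gamma_comm : forall x y, (0 <= x -> 0 <= y -> F x y = F y x)%E;
  Gamma_homol : forall x x' y, (0 <= x -> x <= x' -> 0 <= y ->
    F x y <= F x' y)%E;
  Gamma_homor : forall x y y', (0 <= x -> 0 <= y -> y <= y' ->
    F x y <= F x y')%E;
  Gamma_ge_id : forall x, (0 <= x -> x <= F x 0)%E
}.

Definition constant01 (R : realType) (t : R -> \bar R) : Prop :=
  {in `[0, 1] &, forall x y, t x = t y}.

(* The weak pseudo-inverse; [sup set0 = 0] in the library, by [sup0]. *)
Definition wpinv (R : realType) (t : R -> \bar R) (y : \bar R) : R :=
  if `[< constant01 t >] then 1
  else sup [set x : R | x \in `[0, 1] /\ (t x <= y)%E].

Definition gen_op (R : realType) (t : R -> \bar R)
    (F : \bar R -> \bar R -> \bar R) (x y : R) : R :=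
  wpinv t (F (t x) (t y)).

(* At 0 left continuity is vacuous on [0,1]; for 0 < x the filter x^'- is
   eventually inside [0,1], so values of t outside [0,1] are irrelevant. *)
Definition left_continuous01 (R : realType) (t : R -> \bar R) : Prop :=
  {in `]0, 1], forall x, t y @[y --> x^'-] --> t x}.

Definition right_lim (R : realType) (t : R -> \bar R) (x : R) : \bar R :=
  lim (t y @[y --> x^'+]).

(* Main.v *)
Require Import Defs.
From HB Require Import structures.
From mathcomp Require Import all_boot all_order all_algebra.
From mathcomp Require Import all_classical all_reals all_analysis.
Import Order.TTheory GRing.Theory Num.Theory.
Import numFieldNormedType.Exports.

(** Write d(x) = F(t(x), t(x)).  For non-constant t, T(x,x) is the supremum of
    the sublevel set of the points z of [0,1] with t(z) <= d(x), and this set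
    always contains x, because t(x) <= F(t(x), 0) <= d(x).  So T(x,x) = x says
    that no z > x lies in the set: d(x) < t(z) whenever x < z <= 1.

    The limit t(x^+) is the infimum of t over ]x,1] ([right_limE]).  If d(x)
    exceeded it, some z > x would satisfy t(z) < d(x), and T(x,x) >= z > x
    ([wpinv_ge]); this gives the inequality in the forward direction.  Strict
    monotonicity is injectivity, since t is already non-decreasing, and t is
    injective because T(x,x) depends on x only through t(x).

    Conversely, d(x) <= t(x^+) only yields d(x) <= t(z) for z > x.  Strict
    monotonicity makes this strict: t(x^+) lies below t at the midpoint of x
    and z, which lies strictly below t(z).  Hence x is the largest element of
    the sublevel set, and its supremum ([wpinv_max]). *)

Local Open Scope classical_set_scope.
Local Open Scope ring_scope.

Lemma right_limE {R : realType} {t : R -> \bar R} {x : R} :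
  {in `[0, 1] &, {homo t : a b / a <= b >-> (a <= b)%E}} ->
  x \in `[0, 1[ -> right_lim t x = ereal_inf [set t z | z in `]x, 1]].
Proof.
rewrite in_itv/= => t_homo /andP[x_ge0 x_lt1].
have sub01 z : z \in `]x, 1] -> z \in `[0, 1].
  by rewrite !in_itv/= => /andP[xz ->]; rewrite (le_trans x_ge0 (ltW xz)).
apply: cvg_lim => //; apply: (nondecreasing_at_right_cvge (BRight 1)).
  by rewrite bnd_simp.
by move=> a b /sub01 a01 /sub01 b01; exact: t_homo.
Qed.

(** Valid for constant [t] as well, since the value 1 chosen for the weak
    pseudo-inverse in that case bounds all of [0,1]. *)
Lemma wpinv_ge {R : realType} {t : R -> \bar R} {y : \bar R} {z : R} :
  z \in `[0, 1] -> (t z <= y)%E -> z <= wpinv t y.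
Proof.
move=> z01 tzy; rewrite /wpinv; case: asboolP => _.
  by move: z01; rewrite in_itv/= => /andP[].
apply: ub_le_sup => //; exists 1 => w /= [].
by rewrite in_itv/= => /andP[].
Qed.

Lemma wpinv_max {R : realType} {t : R -> \bar R} {y : \bar R} {x : R} :
  ~ constant01 t -> x \in `[0, 1] -> (t x <= y)%E ->
  {in `[0, 1], forall z, (t z <= y)%E -> z <= x} -> wpinv t y = x.
Proof.
move=> tNcst x01 txy x_max; apply/eqP; rewrite eq_le wpinv_ge// andbT.
rewrite /wpinv; case: asboolP => // _.
by apply: ge_sup => [|z [z01 tzy]]; [exists x|exact: x_max].
Qed.

Lemma Gamma_diag_ge {R : realType} {F : \bar R -> \bar R -> \bar R}
    {a : \bar R} :
  in_Gamma F -> (0 <= a)%E -> (a <= F a a)%E.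
Proof.
move=> F_Gamma a_ge0; apply: le_trans (Gamma_ge_id F_Gamma a_ge0) _.
exact: (Gamma_homor F_Gamma).
Qed.

Theorem theorem6p1 (R : realType) (t : R -> \bar R)
    (F : \bar R -> \bar R -> \bar R)
    (t_ge0 : {in `[0, 1], forall x, (0 <= t x)%E})
    (t_homo : {in `[0, 1] &, {homo t : x y / x <= y >-> (x <= y)%E}})
    (t_lcont : left_continuous01 t)
    (F_Gamma : in_Gamma F) :
  {in `[0, 1], forall x, gen_op t F x x = x} <->
  ({in `[0, 1] &, {homo t : x y / x < y >-> (x < y)%E}} /\
   {in `[0, 1[, forall x, (F (t x) (t x) <= right_lim t x)%E}).
Proof.
split=> [T_idem|[t_incr diag_le] x x01].
  split=> [x y x01 y01 xy|x x01].
    rewrite lt_neqAle t_homo ?(ltW xy)// andbT; apply/eqP => txy.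
    move: xy; rewrite -(T_idem x x01) -(T_idem y y01).
    by rewrite /gen_op txy ltxx.
  rewrite right_limE// leNgt; apply/negP => /ereal_inf_lt[_ [z /= zx1 <-] tz_lt].
  move: x01 zx1; rewrite !in_itv/= => /andP[x_ge0 x_lt1] /andP[xz z_le1].
  have x01 : x \in `[0, 1] by rewrite in_itv/= x_ge0 ltW.
  have z01 : z \in `[0, 1] by rewrite in_itv/= z_le1 (le_trans x_ge0 (ltW xz)).
  have := wpinv_ge z01 (ltW tz_lt).
  by rewrite -/(gen_op t F x x) T_idem// leNgt xz.
have o01 : 0 \in `[0, 1 : R] by rewrite in_itv/= lexx ler01.
have i01 : 1 \in `[0, 1 : R] by rewrite in_itv/= lexx ler01.
apply: wpinv_max => //.
- move=> tcst; have := t_incr 0 1 o01 i01 ltr01.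
  by rewrite (tcst 0 1 o01 i01) ltxx.
- exact/Gamma_diag_ge/t_ge0.
move=> z z01 tz_le; rewrite leNgt; apply/negP => xz.
move: (x01) (z01); rewrite !in_itv/= => /andP[x_ge0 _] /andP[_ z_le1].
have x01' : x \in `[0, 1[ by rewrite in_itv/= x_ge0 (lt_le_trans xz).
have [xm mz] := midf_lt xz; set m := (x + z) / 2%:R in xm mz.
have m_le1 : m <= 1 by rewrite (le_trans (ltW mz)).
have m01 : m \in `[0, 1] by rewrite in_itv/= m_le1 (le_trans x_ge0 (ltW xm)).
have : (t z <= t m)%E.
  apply: le_trans tz_le _; apply: le_trans (diag_le x x01') _.
  rewrite right_limE//; apply: ereal_inf_lbound; exists m => //=.
  by rewrite in_itv/= xm.
by rewrite leNgt t_incr.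
Qed.
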